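(* Let $S\subseteq\mathbb{N}^d$ be a simplicial affine semigroup of embedding dimension $d+2$ and let $\mathbb{K}$ be a field. If $\mathbb{K}[S]$ is Cohen-Macaulay, then $\operatorname{type}(S)\leq 2$.
   Context: $\mathbb{N}$ denotes the nonnegative integers and $d\ge 1$. An affine semigroup is a finitely generated submonoid $S$ of $\mathbb{N}^d$; it has a unique minimal generating set $\operatorname{mgs}(S)$, whose cardinality is the embedding dimension of $S$. $S$ is simplicial if there are $d$ elements of $\operatorname{mgs}(S)$, linearly independent over $\mathbb{Q}$, such that every $\mathbf{a}\in S$ has a positive multiple $n\mathbf{a}$ that is an $\mathbb{N}$-linear combination of these $d$ elements. Equivalently, $\operatorname{cone}(S)$, the set of nonnegative real combinations of elements of $S$, has exactly $d$ one-dimensional extremal rays. The smallest nonzero element of $S$ on each of these rays is called an extremal ray of $S$; these are denoted $\mathbf{a}_1,\dots,\mathbf{a}_d$, and $E=\{\mathbf{a}_1,\dots,\mathbf{a}_d\}$. $\operatorname{Ap}(S,E)=\{\mathbf{a}\in S : \mathbf{a}-\mathbf{a}_i\notin S \text{ for all } i=1,\dots,d\}$, which is a finite set. The partial order $\preceq_S$ is: $\mathbf{x}\preceq_S\mathbf{y}$ iff $\mathbf{y}-\mathbf{x}\in S$. The set of quasi-Frobenius elements is $\operatorname{QF}(S)=\{\mathbf{w}-\sum_{i=1}^d\mathbf{a}_i : \mathbf{w}\in\max_{\preceq_S}\operatorname{Ap}(S,E)\}$, where $\max_{\preceq_S}$ denotes the set of maximal elements, and $\operatorname{type}(S)$ is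 the cardinality of $\operatorname{QF}(S)$. $\mathbb{K}[S]\subseteq\mathbb{K}[x_1,\dots,x_d]$ is the subalgebra spanned by the monomials $\mathbf{x}^{\mathbf{a}}$, $\mathbf{a}\in S$. *)

(* Defs.v *)
From HB Require Import structures.
From mathcomp Require Import all_boot all_order all_algebra finmap.
From mathcomp Require Import reals.
From mathcomp Require Import mpoly.

Set Implicit Arguments.
Unset Strict Implicit.
Unset Printing Implicit Defensive.

Import Order.TTheory GRing.Theory Num.Theory.
Local Open Scope ring_scope.

(* An ideal of [R] is a predicate satisfying the library's [idealr_closed],
   which includes properness ([1 \notin I]). *)
Section CohenMacaulay.
Variable R : comNzRingType.

Definition ideal_gen (xs : seq R) (y : R) : Prop :=
  exists c : 'I_(size xs) -> R, y = \sum_(i < size xs) c i * xs`_i.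

(* The improper ideal is generated by 1, so only proper ideals are considered. *)
Definition noetherian : Prop :=
  forall I : {pred R}, idealr_closed I ->
    exists xs : seq R, forall y, y \in I <-> ideal_gen xs y.

Definition prime_ideal (P : {pred R}) : Prop :=
  idealr_closed P /\ prime_idealr_closed P.

Definition maximal_ideal (M : {pred R}) : Prop :=
  idealr_closed M /\
  forall I : {pred R}, idealr_closed I -> {subset M <= I} -> {subset I <= M}.

Definition regular_seq (xs : seq R) : Prop :=
  ~ ideal_gen xs 1 /\
  forall i, (i < size xs)%N -> forall y,
    ideal_gen (take i xs) (xs`_i * y) -> ideal_gen (take i xs) y.

Definition has_depth (I : {pred R}) (n : nat) : Prop :=
  (exists xs : seq R, [/\ size xs = n, {subset xs <= I} & regular_seq xs]) /\
  (forall xs : seq R, {subset xs <= I} -> regular_seq xs -> (size xs <= n)%N).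

(* c 0 < c 1 < ... < c n = P, a chain of primes of length n. *)
Definition prime_chain (P : {pred R}) (n : nat) (c : nat -> {pred R}) : Prop :=
  [/\ forall i, (i <= n)%N -> prime_ideal (c i),
      forall i, (i < n)%N ->
        {subset c i <= c i.+1} /\ ~ {subset c i.+1 <= c i}
    & c n =i P].

Definition has_height (P : {pred R}) (n : nat) : Prop :=
  (exists c, prime_chain P n c) /\
  (forall m c, prime_chain P m c -> (m <= n)%N).

(* depth M is the largest length of a regular sequence contained in M, and
   height M is the Krull dimension of the localization at M. *)
Definition cohen_macaulay : Prop :=
  noetherian /\
  forall M : {pred R}, maximal_ideal M ->
    exists n, has_depth M n /\ has_height M n.

End CohenMacaulay.

Section Generation.
Variable d : nat.

Definition monoid_gen (A : {fset 'X_{1..d}}) (m : 'X_{1..d}) : Prop :=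
  exists c : 'X_{1..d} -> nat, m = (\sum_(a <- A) a *+ c a)%MM.

Definition generates (A : {fset 'X_{1..d}}) (S : {pred 'X_{1..d}}) : Prop :=
  forall m, m \in S <-> monoid_gen A m.

Definition is_mgs (S : {pred 'X_{1..d}}) (A : {fset 'X_{1..d}}) : Prop :=
  generates A S /\
  forall B : {fset 'X_{1..d}}, (B `<` A)%fset -> ~ generates B S.

Definition embedding_dim (S : {pred 'X_{1..d}}) (n : nat) : Prop :=
  exists2 A : {fset 'X_{1..d}}, is_mgs S A & #|` A|%fset = n.

End Generation.

(* N^d is the type 'X_{1..d} of exponents of monomials in d variables. *)
Record affine_semigroup (d : nat) := AffineSemigroup {
  semigroup_pred :> {pred 'X_{1..d}};
  semigroup0 : 0%MM \in semigroup_pred;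
  semigroupD : {in semigroup_pred &, forall a b, (a + b)%MM \in semigroup_pred};
  semigroup_fg : exists A : {fset 'X_{1..d}}, generates A semigroup_pred
}.

Section SemigroupRing.
Variables (d : nat) (K : fieldType) (S : affine_semigroup d).

Definition semigroup_alg : {pred {mpoly K[d]}} :=
  [pred p : {mpoly K[d]} | all (fun m => m \in S) (msupp p)].

Fact semigroup_alg_subring : subring_closed semigroup_alg.
Proof.
split=> [|p q /allP Sp /allP Sq|p q /allP Sp /allP Sq].
- by rewrite inE msupp1 /= semigroup0.
- apply/allP => m /msuppB_le; rewrite mem_cat => /orP[/Sp|/Sq] //.
- apply/allP => m /msuppM_le /allpairsP[[a b] /= [pa qb ->]].
  by apply: semigroupD; [exact: Sp | exact: Sq].
Qed.

HB.instance Definition _ :=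
  GRing.isSubringClosed.Build {mpoly K[d]} semigroup_alg semigroup_alg_subring.

Record semigroup_ring := SemigroupRing {
  semigroup_ring_val : {mpoly K[d]};
  _ : semigroup_ring_val \in semigroup_alg
}.

HB.instance Definition _ := [isSub for semigroup_ring_val].
HB.instance Definition _ := [Choice of semigroup_ring by <:].
HB.instance Definition _ := [SubChoice_isSubComNzRing of semigroup_ring by <:].

End SemigroupRing.

Definition mnm_vec (A : nzRingType) (d : nat) (m : 'X_{1..d}) : 'rV[A]_d :=
  \row_i (m i)%:R.

Section Simplicial.
Variables (d : nat) (S : {pred 'X_{1..d}}).

Definition simplicial : Prop :=
  exists A : {fset 'X_{1..d}}, is_mgs S A /\
  exists b : 'I_d -> 'X_{1..d},
    [/\ forall i, b i \in A,
        row_free (\matrix_(i < d) mnm_vec rat (b i))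
      & forall a, a \in S -> exists n : nat, (0 < n)%N /\
          exists c : 'I_d -> nat, (a *+ n = \sum_(i < d) b i *+ c i)%MM].

End Simplicial.

(* [R : realType] is an arbitrary model of the real numbers. *)
Section ExtremalRays.
Variables (R : realType) (d : nat).

Definition cone (S : {pred 'X_{1..d}}) (x : 'rV[R]_d) : Prop :=
  exists (n : nat) (s : 'I_n -> 'X_{1..d}) (c : 'I_n -> R),
    [/\ forall i, s i \in S, forall i, 0 <= c i
      & x = \sum_(i < n) c i *: mnm_vec R (s i)].

Definition ray (u x : 'rV[R]_d) : Prop := exists2 t : R, 0 <= t & x = t *: u.

(* The half-line spanned by u is a one-dimensional face of the convex cone C. *)
Definition spans_extremal_ray (C : 'rV[R]_d -> Prop) (u : 'rV[R]_d) : Prop :=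
  [/\ u != 0, C u
    & forall x y, C x -> C y -> ray u (x + y) -> ray u x /\ ray u y].

(* On a half-line the componentwise order [(a <= b)%MM] is the natural one. *)
Definition extremal_ray (S : {pred 'X_{1..d}}) (a : 'X_{1..d}) : Prop :=
  [/\ a \in S, spans_extremal_ray (cone S) (mnm_vec R a)
    & forall b, b \in S -> b != 0%MM -> ray (mnm_vec R a) (mnm_vec R b) ->
        (a <= b)%MM].

End ExtremalRays.

Section QuasiFrobenius.
Variables (d : nat) (S : {pred 'X_{1..d}}).

(* Differences are taken in Z^d: subtraction on 'X_{1..d} is truncated. *)
Definition in_semigroup (v : 'rV[int]_d) : Prop :=
  exists2 s, s \in S & v = mnm_vec int s.

Definition semigroup_le (x y : 'X_{1..d}) : Prop :=
  in_semigroup (mnm_vec int y - mnm_vec int x).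

Definition apery (E : {fset 'X_{1..d}}) (a : 'X_{1..d}) : Prop :=
  a \in S /\
  forall e, e \in E -> ~ in_semigroup (mnm_vec int a - mnm_vec int e).

Definition max_apery (E : {fset 'X_{1..d}}) (w : 'X_{1..d}) : Prop :=
  apery E w /\ forall y, apery E y -> semigroup_le w y -> y = w.

Definition quasi_frobenius (E : {fset 'X_{1..d}}) (v : 'rV[int]_d) : Prop :=
  exists2 w, max_apery E w & v = mnm_vec int w - \sum_(e <- E) mnm_vec int e.

End QuasiFrobenius.

(* QF(S), formed with E the set of extremal rays of S, has exactly n elements. *)
Definition has_type (R : realType) (d : nat) (S : {pred 'X_{1..d}}) (n : nat)
    : Prop :=
  exists2 E : {fset 'X_{1..d}}, (forall a, a \in E <-> extremal_ray R S a) &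
  exists2 Q : {fset 'rV[int]_d},
    (forall v, v \in Q <-> quasi_frobenius S E v) & #|` Q|%fset = n.

(* Main.v *)
Require Import Defs.
From HB Require Import structures.
From mathcomp Require Import all_boot all_order all_algebra finmap.
From mathcomp Require Import reals.
From mathcomp Require Import mpoly.
From mathcomp Require Import boolp.
From mathcomp Require Import ring lra zify.

(** Let [e_1, ..., e_d] be the extremal rays and [M] the maximal ideal of [K[S]]
    spanned by the monomials [x^s], [s <> 0]. The primes spanned by the monomials
    off the faces of a flag of the cone show that [M] has height at least [d], so
    [M] contains a regular sequence of length [d]. As [M] is the radical of
    [(x^{e_1}, ..., x^{e_d})], the Koszul complex of the [x^{e_i}] is then
    acyclic in positive degrees. In multidegree [s], vanishing of the first
    homology says that the graph on [{i | s - e_i in S}] with edges [{i, j}] for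
    [s - e_i - e_j in S] is connected; by induction on [s], each element of [S]
    is then uniquely the sum of an element of the Apery set and an
    [N]-combination of the [e_i], so that the Apery set meets each coset of the
    group spanned by the [e_i] in at most one point. Elements of the Apery set
    are combinations [l b + m c] of the two remaining generators. The
    lexicographically smallest pairs [(l, m)] form an order ideal of [N^2] tiling
    [Z^2] under a lattice, which forces an L-shape with at most two corners, and
    every maximal element of the Apery set is a corner. *)

Set Implicit Arguments.
Unset Strict Implicit.
Unset Printing Implicit Defensive.

Import Order.TTheory GRing.Theory Num.Theory.
Local Open Scope ring_scope.

(** * Koszul complexes and regular sequences *)

Section Koszul.
Variables (A : comNzRingType) (g : nat -> A).

(* The Koszul complex of [g 0, ..., g n.-1] as an iterated mapping cone: in
   [koszul m.+1] the pair [(a, b)] stands for [a + b e_m]. *)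
Fixpoint koszul n : lmodType A :=
  if n is m.+1 then (koszul m * koszul m)%type else A^o.

Lemma koszul_eq n (x y : koszul n.+1) : x.1 = y.1 -> x.2 = y.2 -> x = y.
Proof. by case: x y => [? ?] [? ?] /= -> ->. Qed.

(** The signs are those of [e_m] written on the left: [e_m b] goes to [g m *: b - e_m (bd b)]. *)
Fixpoint bd n : koszul n -> koszul n :=
  match n with
  | 0 => fun _ => 0
  | m.+1 => fun z => (bd z.1 + g m *: z.2, - bd z.2)
  end.

Lemma bd_linear n : linear (@bd n).
Proof.
elim: n => [|n IH] a x y; first by rewrite /= scaler0 addr0.
apply: koszul_eq; rewrite /= !IH; last by rewrite opprD scalerN.
rewrite !scalerDr !scalerA [g n * a]mulrC -!addrA; congr (_ + _).
by rewrite addrCA.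
Qed.

HB.instance Definition _ n :=
  GRing.isLinear.Build A (koszul n) (koszul n) *:%R (@bd n) (@bd_linear n).

Lemma bdK n (z : koszul n) : bd (bd z) = 0.
Proof.
elim: n z => [|n IH] z //=; apply: koszul_eq => /=.
  by rewrite linearD linearZ /= IH add0r scalerN subrr.
by rewrite linearN /= IH !oppr0.
Qed.

(* All components of exterior degree less than [i] vanish. *)
Fixpoint deg_ge n i : koszul n -> Prop :=
  match n with
  | 0 => fun z => (0 < i)%N -> z = 0
  | m.+1 => fun z => deg_ge i z.1 /\ deg_ge i.-1 z.2
  end.

Lemma deg_ge_lin n i a (x y : koszul n) :
  deg_ge i x -> deg_ge i y -> deg_ge i (a *: x + y).
Proof.
elim: n i x y => [|n IH] i x y /=.
  by move=> hx hy i0; rewrite hx // hy // scaler0 addr0.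
by move=> [? ?] [? ?]; split; apply: IH.
Qed.

Lemma deg_ge0 n i : deg_ge i (0 : koszul n).
Proof. by elim: n i => [|n IH] i //=; split; apply: IH. Qed.

Lemma deg_geZ n i a (x : koszul n) : deg_ge i x -> deg_ge i (a *: x).
Proof. by move=> hx; rewrite -[_ *: _]addr0; apply: deg_ge_lin => //; apply: deg_ge0. Qed.

Lemma deg_geN n i (x : koszul n) : deg_ge i x -> deg_ge i (- x).
Proof. by rewrite -scaleN1r; apply: deg_geZ. Qed.

Lemma deg_geD n i (x y : koszul n) : deg_ge i x -> deg_ge i y -> deg_ge i (x + y).
Proof. by rewrite -[x in x + y]scale1r; apply: deg_ge_lin. Qed.

Lemma deg_geB n i (x y : koszul n) : deg_ge i x -> deg_ge i y -> deg_ge i (x - y).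
Proof. by move=> hx hy; apply: deg_geD => //; apply: deg_geN. Qed.

Lemma deg_ge_bd n i (z : koszul n) : deg_ge i.+1 z -> deg_ge i (bd z).
Proof.
elim: n i z => [|n IH] i z //= [h1 h2]; split.
  by apply: deg_geD; [apply: IH | apply: deg_geZ].
(* For [i = 0] the predecessor is truncated, and [deg_ge 0] holds of every element. *)
apply: deg_geN; case: i h1 h2 => [|i] h1 h2; last exact: IH.
by elim: (n) (bd _) => //= m IHm x; split; apply: IHm.
Qed.

Lemma deg_ge_top n i (z : koszul n) : (n < i)%N -> deg_ge i z -> z = 0.
Proof.
elim: n i z => [|n IH] i z /= ni; first exact.
move=> [h1 h2]; apply: koszul_eq; first exact: IH (ltnW ni) h1.
by apply: IH h2; case: i ni {h1}.
Qed.

Fixpoint coef_in (I : A -> Prop) n : koszul n -> Prop :=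
  match n with
  | 0 => fun z => I z
  | m.+1 => fun z => coef_in I z.1 /\ coef_in I z.2
  end.

(** Unlike [idealr_closed], this admits the unit ideal. *)
Definition is_ideal (I : A -> Prop) :=
  I 0 /\ forall a x y, I x -> I y -> I (a * x + y).

Section CoefIn.
Variables (I : A -> Prop) (idI : is_ideal I).

Lemma coef_in0 n : coef_in I (0 : koszul n).
Proof. by elim: n => [|n IH] //=; exact: idI.1. Qed.

Lemma coef_in_lin n a (x y : koszul n) :
  coef_in I x -> coef_in I y -> coef_in I (a *: x + y).
Proof.
elim: n x y => [|n IH] x y /=; first exact: idI.2.
by move=> [? ?] [? ?]; split; apply: IH.
Qed.

Lemma coef_inZ n a (x : koszul n) : coef_in I x -> coef_in I (a *: x).
Proof. by move=> hx; rewrite -[_ *: _]addr0; apply: coef_in_lin => //; apply: coef_in0. Qed.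

Lemma coef_inN n (x : koszul n) : coef_in I x -> coef_in I (- x).
Proof. by rewrite -scaleN1r; apply: coef_inZ. Qed.

Lemma coef_inD n (x y : koszul n) : coef_in I x -> coef_in I y -> coef_in I (x + y).
Proof. by rewrite -[x in x + y]scale1r; apply: coef_in_lin. Qed.

Lemma coef_in_bd n (z : koszul n) : coef_in I z -> coef_in I (bd z).
Proof.
elim: n z => [|n IH] z /=; first by move=> _; exact: idI.1.
move=> [? ?]; split; last by apply: coef_inN; apply: IH.
by apply: coef_inD; [apply: IH|apply: coef_inZ].
Qed.

Lemma coef_in_regular n f (z : koszul n) :
  (forall y, I (f * y) -> I y) -> coef_in I (f *: z) -> coef_in I z.
Proof. by move=> reg; elim: n z => [|n IH] z /=; [exact: reg | move=> [/IH? /IH?]]. Qed.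

(** Used with [J] generated by [I] and [f]. Components below degree [i] are lifted to zero, so the
    degree bound passes to [v]. *)
Lemma coef_in_split (J : A -> Prop) n i f (z : koszul n) :
    (forall x, J x -> exists v, I (x - f * v)) ->
    deg_ge i z -> coef_in J z ->
  exists2 v : koszul n, deg_ge i v & coef_in I (z - f *: v).
Proof.
move=> dJ; elim: n i z => [|n IH] i z /=.
  case: i => [_ /dJ[v Iv]|i /(_ isT)-> _]; first by exists v.
  by exists 0 => //; rewrite scaler0 subr0; exact: idI.1.
move=> [h1 h2] [/(IH _ _ h1)[v1 ? ?] /(IH _ _ h2)[v2 ? ?]].
by exists (v1, v2).
Qed.

End CoefIn.

(** Exterior multiplication by [e_j] on the left; it is a homotopy between multiplication by [g j]
    and zero. *)
Fixpoint contract n j : koszul n -> koszul n :=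
  match n with
  | 0 => fun _ => 0
  | m.+1 => fun z =>
     if j == m then (0, z.1) else (contract j z.1, - contract j z.2)
  end.

Lemma contract_linear n j : linear (@contract n j).
Proof.
elim: n => [|n IH] a x y; first by rewrite /= scaler0 addr0.
rewrite /=; case: eqP => _; apply: koszul_eq => //=.
- by rewrite scaler0 addr0.
- exact: IH.
- by rewrite IH opprD scalerN.
Qed.

HB.instance Definition _ n j :=
  GRing.isLinear.Build A (koszul n) (koszul n) *:%R (@contract n j)
    (@contract_linear n j).

Lemma contractP n j (z : koszul n) : (j < n)%N ->
  bd (contract j z) + contract j (bd z) = g j *: z.
Proof.
elim: n z => [|n IH] z // jn.
have [->|jNn] /= := eqVneq j n.
  apply: koszul_eq => /=; first by rewrite eqxx /= linear0 add0r addr0.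
  by rewrite eqxx /= addrC addrAC subrr add0r.
have {}jn : (j < n)%N by rewrite ltn_neqAle jNn.
rewrite (negbTE jNn); apply: koszul_eq => /=.
  by rewrite linearD (linearZ_LR (contract j)) /= -IH // scalerN addrACA addNr addr0.
by rewrite !linearN /= !opprK IH.
Qed.

Lemma deg_ge_contract n i j (z : koszul n) : deg_ge i z -> deg_ge i.+1 (contract j z).
Proof.
elim: n i z => [|n IH] i z //= [h1 h2]; case: eqP => _; split => //=.
- exact: deg_ge0.
- exact: IH.
- apply: deg_geN; case: i h1 h2 => [|i] h1 h2; last exact: IH.
  by elim: (n) (contract _ _) => //= m IHm x; split; apply: IHm.
Qed.

Lemma coef_in_contract I n j (z : koszul n) : is_ideal I ->
  coef_in I z -> coef_in I (contract j z).
Proof.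
move=> idI; elim: n z => [|n IH] z /=; first by move=> _; exact: idI.1.
move=> [? ?]; case: eqP => _; split => //=; first exact: coef_in0.
  exact: IH.
by apply: coef_inN => //; apply: IH.
Qed.

(** The homotopies add up: the ideal generated by the [g j] annihilates Koszul homology, here modulo
    [I]. *)
Lemma bd_contract n I i (c : nat -> A) (z : koszul n) : is_ideal I ->
    deg_ge i z -> coef_in I (bd z) ->
  exists2 y : koszul n, deg_ge i.+1 y
    & coef_in I ((\sum_(j < n) c j * g j) *: z - bd y).
Proof.
move=> idI hz hI; exists (\sum_(j < n) c j *: contract j z).
  elim/big_ind: _ => [|x y|j _]; first exact: deg_ge0.
    exact: deg_geD.
  by apply: deg_geZ; apply: deg_ge_contract.
rewrite linear_sum /= scaler_suml -sumrB.
elim/big_ind: _ => [|x y|j _]; first exact: coef_in0.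
  exact: coef_inD.
rewrite linearZ /= -scalerA -scalerBr; apply: coef_inZ => //.
by rewrite -contractP // addrC addrA addNr add0r; apply: coef_in_contract.
Qed.

End Koszul.

Section IdealGen.
Variable A : comNzRingType.
Implicit Types (s : seq A).

Lemma ideal_gen_ideal s : is_ideal (ideal_gen s).
Proof.
split; first by exists (fun _ => 0); rewrite big1 // => i _; rewrite mul0r.
move=> a x y [c ->] [c' ->]; exists (fun i => a * c i + c' i).
rewrite mulr_sumr -big_split /=; apply: eq_bigr => i _.
by rewrite mulrDl mulrA.
Qed.

Lemma ideal_gen_rcons s f x :
  ideal_gen (rcons s f) x <-> exists v, ideal_gen s (x - f * v).
Proof.
rewrite /ideal_gen size_rcons; split=> [[c ->]|[v [c /eqP]]].
  exists (c ord_max), (fun i => c (widen_ord (leqnSn _) i)).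
  rewrite big_ord_recr /= nth_rcons ltnn eqxx [f * _]mulrC addrK.
  by apply: eq_bigr => i _; rewrite nth_rcons ltn_ord.
rewrite subr_eq => /eqP->.
exists (fun i => if unlift ord_max i is Some j then c j else v).
rewrite big_ord_recr /= nth_rcons ltnn eqxx unlift_none [f * _]mulrC.
congr (_ + _); apply: eq_bigr => i _; rewrite nth_rcons ltn_ord.
have -> : widen_ord (leqnSn (size s)) i = lift ord_max i.
  by apply: val_inj; rewrite /= /bump leqNgt ltn_ord.
by rewrite liftK.
Qed.

Lemma ideal_gen_nil x : ideal_gen [::] x -> x = 0 :> A.
Proof. by move=> [c ->]; rewrite big_ord0. Qed.

End IdealGen.

(** * Acyclicity of the Koszul complex and first syzygies *)

Section DepthSensitivity.
Variables (A : comNzRingType) (g : nat -> A) (n : nat) (fs : seq A).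
Hypothesis fs_regular : regular_seq fs.
Hypothesis size_fs : (n <= size fs)%N.
Hypothesis fs_radical : forall f, f \in fs ->
  exists N (c : nat -> A), f ^+ N = \sum_(j < n) c j * g j.

Let I k := ideal_gen (take k fs).

Let idI k : is_ideal (I k). Proof. exact: ideal_gen_ideal. Qed.

(* Downward induction on [k]: multiplication by the next regular element is
   injective on homology in degrees above [k] because the homology modulo that
   element vanishes one degree higher, and it is nilpotent because [g] kills
   Koszul homology. *)
Lemma koszul_acyclic_mod k (z : koszul A n) : (k <= n)%N ->
    deg_ge k.+1 z -> coef_in (I k) (bd g z) ->
  exists2 y : koszul A n, deg_ge k.+2 y & coef_in (I k) (z - bd g y).
Proof.
move=> kn; have [m] := ubnP (n - k)%N.
elim: m => // m IHm in k kn z *; rewrite ltnS => nk hz hbz.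
have [nlek|k_lt_n] := leqP n k.
  exists 0; first exact: deg_ge0.
  by rewrite linear0 subr0 (deg_ge_top _ hz) ?ltnS//; exact: coef_in0.
have kfs : (k < size fs)%N by apply: leq_trans size_fs.
set f := fs`_k.
have IS x : I k.+1 x <-> exists v, I k (x - f * v).
  by rewrite /I (take_nth 0 kfs); exact: ideal_gen_rcons.
(* A diagram chase: if [f *: u] is the boundary of [y] modulo [I k], then [y] is a cycle modulo
   [I k.+1], so [y = bd v + f *: x] modulo [I k]. Taking boundaries, [f] kills [u - bd x] modulo
   [I k], and [f] is regular there. *)
have descent (u : koszul A n) : deg_ge k.+1 u ->
    (exists2 y : koszul A n, deg_ge k.+2 y & coef_in (I k) (f *: u - bd g y)) ->
    exists2 y : koszul A n, deg_ge k.+2 y & coef_in (I k) (u - bd g y).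
  move=> hu [y hy Iy].
  have sub1 l (x : koszul A l) : coef_in (I k) x -> coef_in (I k.+1) x.
    elim: l x => [|l IHl] x /=; last by move=> [/IHl? /IHl?].
    by move=> Ix; apply/IS; exists 0; rewrite mulr0 subr0.
  have sub2 l (x : koszul A l) : coef_in (I k.+1) (f *: x).
    elim: l x => [|l IHl] x /=; last by split; apply: IHl.
    by apply/IS; exists x; rewrite subrr; exact: (idI _).1.
  have bdy : coef_in (I k.+1) (bd g y).
    rewrite -[bd g y](subKr (f *: u)); apply: coef_inD => //.
    by apply: coef_inN => //; exact: sub1.
  have [|v hv Iv] := IHm k.+1 k_lt_n y _ hy bdy; first by lia.
  have hyv : deg_ge k.+2 (y - bd g v) by apply: deg_geB => //; exact: deg_ge_bd.
  have [x hx Ix] := coef_in_split (idI k) (fun x => (IS x).1) hyv Iv.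
  exists x => //; apply: (coef_in_regular (f := f)); first exact: fs_regular.2.
  have -> : f *: (u - bd g x) = (f *: u - bd g y) + (bd g y - f *: bd g x).
    by rewrite scalerBr addrA subrK.
  apply: coef_inD => //.
  have := coef_in_bd g (idI k) Ix.
  by rewrite linearB linearB linearZ_LR /= bdK subr0.
(* Some power of [f] lies in the ideal of the [g j] and so makes [z] a boundary; [descent] then
   removes the factors [f] one by one. *)
have [N [c fNE]] := fs_radical (mem_nth 0 kfs).
have : exists2 y : koszul A n, deg_ge k.+2 y & coef_in (I k) (f ^+ N *: z - bd g y).
  by rewrite fNE; exact: bd_contract.
elim: N {fNE} => [|N IHN]; first by rewrite expr0 scale1r.
by rewrite exprS -scalerA => /descent h; apply: IHN; apply: h; exact: deg_geZ.
Qed.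

Lemma koszul_acyclic (z : koszul A n) :
  deg_ge 1 z -> bd g z = 0 -> exists y, z = bd g y.
Proof.
move=> hz bz; have [|y _ h] := koszul_acyclic_mod (leq0n n) hz.
  by rewrite bz; exact: coef_in0.
exists y; apply/eqP; rewrite -subr_eq0; apply/eqP.
elim: (n) (z - _) h => [|l IHl] x /=; first by rewrite /I take0; exact: ideal_gen_nil.
by case: x => a b /= [/IHl-> /IHl->].
Qed.

Fixpoint deg0_part l : koszul A l -> A :=
  if l is m.+1 then fun z => deg0_part z.1 else id.

Fixpoint deg0_inj l (p : A) : koszul A l :=
  if l is m.+1 then (deg0_inj m p, 0) else p.

Fixpoint deg1_inj l i (p : A) : koszul A l :=
  if l is m.+1 then
    if i == m then (0, deg0_inj m p) else (deg1_inj m i p, 0)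
  else 0.

Lemma deg0_part_linear l : linear (@deg0_part l : koszul A l -> A^o).
Proof. by elim: l => //= l IH a x y; rewrite IH. Qed.

HB.instance Definition _ l := GRing.isLinear.Build A (koszul A l) A^o *:%R
  (@deg0_part l) (@deg0_part_linear l).

Lemma deg0_partZ l a (x : koszul A l) : deg0_part (a *: x) = a * deg0_part x.
Proof. exact: linearZ_LR. Qed.

Lemma deg0_partK l p : deg0_part (deg0_inj l p) = p.
Proof. by elim: l. Qed.

Lemma deg0_injZ l a p : a *: deg0_inj l p = deg0_inj l (a * p).
Proof. by elim: l => // l IH; apply: koszul_eq; rewrite /= ?IH ?scaler0. Qed.

Lemma bd_deg0 l p : bd g (deg0_inj l p) = 0.
Proof.
elim: l => // l IH; apply: koszul_eq => /=; first by rewrite IH scaler0 addr0.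
by rewrite linear0 oppr0.
Qed.

Lemma bd_deg1 l i p : (i < l)%N -> bd g (deg1_inj l i p) = deg0_inj l (g i * p).
Proof.
elim: l => //= l IH il; case: eqVneq il => [-> _|il1 il2] /=.
  apply: koszul_eq => /=; first by rewrite linear0 add0r deg0_injZ.
  by rewrite bd_deg0 oppr0.
apply: koszul_eq => /=; last by rewrite linear0 oppr0.
by rewrite scaler0 addr0 IH // ltn_neqAle il1.
Qed.

Lemma deg_ge1_deg1 l i p : deg_ge 1 (deg1_inj l i p).
Proof.
elim: l => //= l IH; case: eqP => _; split => //=; try exact: deg_ge0.
by elim: (l) (deg0_inj _ _) => //= m IHm x; split; apply: IHm.
Qed.

Variables (V : zmodType) (ell : {additive A -> V}) (U : pred nat).
Hypothesis ellU : forall i j r, U i -> ~~ U j -> ell (g i * g j * r) = 0.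

(** On a degree one part [\sum_i p_i e_i] this sums [ell (g i * p_i)] over [i] in [U]. It is later
    applied with [ell] the coefficient of [x^s] and with no edge of the graph of [s] leaving [U]. *)
Fixpoint cut l : koszul A l -> V :=
  if l is m.+1 then fun z =>
    cut z.1 + (if U m then ell (g m * deg0_part z.2) else 0)
  else fun _ => 0.

Lemma cut_is_additive l : additive (@cut l).
Proof.
elim: l => [|l IH] x y /=; first by rewrite subr0.
rewrite IH raddfB; case: ifP => _; last by rewrite !addr0.
by rewrite mulrBr raddfB /= opprD addrACA.
Qed.

HB.instance Definition _ l :=
  GRing.isAdditive.Build (koszul A l) V (@cut l) (@cut_is_additive l).

(** With [x_i] the degree one coefficients of [x], both sides sum terms [ell (g i * g m * x_i)];
    those with exactly one of [i] and [m] in [U] vanish by [ellU]. This makes the two contributions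
    in [cut_bd] cancel. *)
Lemma cutZ l m (x : koszul A l) :
  cut (g m *: x) = if U m then ell (g m * deg0_part (bd g x)) else 0.
Proof.
elim: l x => [|l IH] x /=; first by rewrite mulr0 raddf0 if_same.
rewrite IH raddfD deg0_partZ mulrDr raddfD /=.
rewrite [deg0_part (g l *: x.2)](deg0_partZ (g l) x.2).
case Um: (U m); case Ul: (U l); rewrite ?addr0 ?add0r //.
- by rewrite mulrCA.
- by rewrite [in X in _ = _ + X]mulrA ellU ?Ul ?Um ?addr0.
- by rewrite mulrA ellU ?Um.
Qed.

Lemma cut_bd l (y : koszul A l) : cut (bd g y) = 0.
Proof.
elim: l y => [|l IH] y //=; rewrite raddfD /= IH add0r cutZ.
by case: ifP => _; rewrite ?addr0 // -raddfD /= -mulrDr raddfN /= subrr mulr0 raddf0.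
Qed.

Lemma cut_deg1 l i p : (i < l)%N ->
  cut (deg1_inj l i p) = if U i then ell (g i * p) else 0.
Proof.
elim: l => //= l IH il; case: eqVneq il => [-> _|il1 il2] /=.
  by rewrite raddf0 add0r deg0_partK.
by rewrite raddf0 mulr0 raddf0 if_same addr0 IH // ltn_neqAle il1.
Qed.

(* The syzygy [(p, - q)] of [(g i, g j)] is a Koszul boundary, and [cut]
   vanishes on boundaries. *)
Lemma regular_cut i j p q : (i < n)%N -> (j < n)%N -> U i -> ~~ U j ->
  g i * p = g j * q -> ell (g i * p) = 0.
Proof.
move=> ilt jlt Ui Uj pq.
have [||y zy] := koszul_acyclic (z := deg1_inj n i p - deg1_inj n j q).
- by apply: deg_geB; exact: deg_ge1_deg1.
- by rewrite linearB /= !bd_deg1 // pq subrr.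
have := cut_bd y; rewrite -zy raddfB /= !cut_deg1 // Ui (negbTE Uj) subr0.
exact.
Qed.

End DepthSensitivity.

(** * Apery sets with two further generators *)

Lemma mulmnDr d (m : 'X_{1..d}) i j : (m *+ (i + j) = m *+ i + m *+ j)%MM.
Proof. by apply/mnmP => k; rewrite !mnmDE !mulmnE mulnDr. Qed.

Lemma affine_semigroupMn d (S : affine_semigroup d) a k :
  a \in S -> (a *+ k)%MM \in S.
Proof.
move=> Sa; elim: k => [|k IH]; first exact: semigroup0.
by rewrite mulmS; exact: semigroupD.
Qed.

Section Apery.
Variables (d n : nat) (S : affine_semigroup d) (e : 'I_n -> 'X_{1..d}).
Hypothesis e_neq0 : forall i, e i != 0%MM.

Definition is_apery w :=
  w \in S /\ forall i m, m \in S -> w <> (m + e i)%MM.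

Definition cmb (c : 'I_n -> nat) := (\sum_i e i *+ c i)%MM.

Lemma cmbD c c' : cmb (fun i => c i + c' i)%N = (cmb c + cmb c')%MM.
Proof. by rewrite /cmb -big_split /=; apply: eq_bigr => i _; rewrite mulmnDr. Qed.

Lemma cmb0 : cmb (fun=> 0%N) = 0%MM.
Proof. exact: big1. Qed.

Lemma cmb1 i : cmb (fun j => j == i)%N = e i.
Proof.
rewrite /cmb (bigD1 i) //= eqxx big1 ?addm0 // => j /negbTE ->.
exact: mulm0n.
Qed.

Lemma cmb_recr i c : (0 < c i)%N ->
  exists c', cmb c = (cmb c' + e i)%MM.
Proof.
move=> ci; exists (fun j => c j - (j == i))%N; rewrite -(cmb1 i) -cmbD.
by congr cmb; apply: funext => j; case: eqP => [->|_] /=; lia.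
Qed.

Lemma mdeg_lt_addl i m : (mdeg m < mdeg (m + e i)%MM)%N.
Proof. by rewrite mdegD -[X in (X < _)%N]addn0 ltn_add2l lt0n mdeg_eq0. Qed.

Definition base w s := is_apery w /\ exists c, s = (w + cmb c)%MM.

Lemma base_add w s i : base w s -> base w (s + e i)%MM.
Proof.
move=> [Aw [c ->]]; split=> //; exists (fun j => c j + (j == i))%N.
by rewrite cmbD cmb1 addmA.
Qed.

Lemma base_exists s : s \in S -> exists w, base w s.
Proof.
have [k] := ubnP (mdeg s); elim: k s => // k IH s sk Ss.
have [[i [m [Sm sE]]]|nA] := EM (exists i m, m \in S /\ s = (m + e i)%MM).
  have [|w bw] := IH m _ Sm.
    by move: sk; rewrite sE ltnS; apply: leq_trans; exact: mdeg_lt_addl.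
  by exists w; rewrite sE; exact: base_add.
exists s; split; last by exists (fun=> 0%N); rewrite cmb0 addm0.
by split=> // i m Sm sE; apply: nA; exists i, m.
Qed.

(* The graph on the indices [i] with [s - e i] in [S], where [i] and [j] are
   adjacent when [s - e i - e j] is in [S], is connected for every [s]. *)
Hypothesis e_connected : forall (U : pred 'I_n) s i j m m',
  U i -> ~~ U j -> m \in S -> m' \in S -> s = (m + e i)%MM -> s = (m' + e j)%MM ->
  exists i' j' m'', [/\ U i', ~~ U j', m'' \in S & s = (m'' + e i' + e j')%MM].

Hypothesis eS : forall i, e i \in S.

Lemma cmb_in c : cmb c \in S.
Proof.
rewrite /cmb; elim/big_ind: _ => [|x y|i _]; first exact: semigroup0.
  exact: semigroupD.
exact: affine_semigroupMn.
Qed.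

(** Let [U] be the set of [i] such that [s - e i] has base [w]. If an index [j] occurring in the
    decomposition over [w'] lies in [U], induction applies to [s - e j]. Otherwise some edge
    [{i', j'}] leaves [U]. A base [v] of [m = s - e i' - e j'] is also one of [s - e i'], so [v = w]
    by induction; then [w] is a base of [s - e j'] too, contradicting that [j'] is outside [U]. *)
Lemma base_unique w w' s : base w s -> base w' s -> w = w'.
Proof.
have [k] := ubnP (mdeg s); elim: k s w w' => // k IH s w w' sk bw bw'.
have [Aw [c sE]] := bw; have [Aw' [c' sE']] := bw'.
have small m i : s = (m + e i)%MM -> (mdeg m < k)%N.
  by move=> sm; move: sk; rewrite sm ltnS; apply: leq_trans; exact: mdeg_lt_addl.
have apery_trivial v v' (a a' : 'I_n -> nat) : is_apery v -> is_apery v' ->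
    (forall i, a i = 0%N) -> s = (v + cmb a)%MM -> s = (v' + cmb a')%MM -> v = v'.
  move=> [Sv Av] [Sv' _] a0.
  have -> : cmb a = 0%MM by rewrite -cmb0; congr cmb; apply: funext.
  rewrite addm0 => ->.
  have [[i ai]|] := EM (exists i, (0 < a' i)%N).
    have [a'' ->] := cmb_recr ai; rewrite addmA => /Av[].
    by apply: semigroupD => //; exact: cmb_in.
  move=> /forallNP a'0 ->; have -> : cmb a' = 0%MM.
    by rewrite -cmb0; congr cmb; apply: funext => i; have := a'0 i; lia.
  by rewrite addm0.
have [[i ci]|/forallNP c0] := EM (exists i, (0 < c i)%N); last first.
  by apply: apery_trivial sE sE' => // i; have := c0 i; lia.
have [[j c'j]|/forallNP c0] := EM (exists i, (0 < c' i)%N); last first.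
  by symmetry; apply: apery_trivial sE' sE => // l; have := c0 l; lia.
pose U i := `[< exists2 m, s = (m + e i)%MM & base w m >].
have [a cE] := cmb_recr ci; have [a' c'E] := cmb_recr c'j.
have [Uj|Uj] := boolP (U j).
  move/asboolP: Uj => [m sm bm].
  apply: (IH m) => //; first exact: small sm.
  split=> //; exists a'; apply: (@addIm _ (e j)).
  by rewrite -sm sE' c'E addmA.
have Ui : U i.
  apply/asboolP; exists (w + cmb a)%MM; first by rewrite sE cE addmA.
  by split=> //; exists a.
have [||||i' [j' [m [/asboolP[m1 sm1 bm1] /asboolP Uj' Sm sm]]]] :=
  e_connected (m := (w + cmb a)%MM) (m' := (w' + cmb a')%MM) (s := s) Ui Uj.
- by apply: semigroupD; [exact: Aw.1|exact: cmb_in].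
- by apply: semigroupD; [exact: Aw'.1|exact: cmb_in].
- by rewrite sE cE addmA.
- by rewrite sE' c'E addmA.
case: Uj'; exists (m + e i')%MM => //.
have m1E : m1 = (m + e j')%MM.
  by apply: (@addIm _ (e i')); rewrite -sm1 sm -!addmA [(e i' + _)%MM]addmC.
have [v bv] := base_exists Sm.
suff -> : w = v by exact: base_add.
apply: (IH m1) => //; first exact: small sm1.
by rewrite m1E; exact: base_add.
Qed.

(** Congruence modulo the group spanned by the [e i], written without subtraction. *)
Definition sim s t := exists c c', (s + cmb c = t + cmb c')%MM.

Lemma sim_sym s t : sim s t -> sim t s.
Proof. by move=> [c [c' ?]]; exists c', c. Qed.

Lemma sim_trans t s r : sim s t -> sim t r -> sim s r.
Proof.
move=> [c [c' E1]] [a [a' E2]].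
exists (fun i => c i + a i)%N, (fun i => a' i + c' i)%N.
rewrite !cmbD addmA E1 addmA -E2 -!addmA; congr (_ + _)%MM; exact: addmC.
Qed.

Lemma sim_cancel t s r : sim (s + t)%MM (r + t)%MM -> sim s r.
Proof.
move=> [c [c' E]]; exists c, c'; apply: (@addIm _ t).
by rewrite ![(_ + t)%MM]addmC !addmA ![(t + _)%MM]addmC.
Qed.

Lemma apery_sim w w' : is_apery w -> is_apery w' -> sim w w' -> w = w'.
Proof.
move=> Aw Aw' [c [c' E]]; apply: (@base_unique w w' (w + cmb c)%MM).
  by split=> //; exists c.
by split=> //; exists c'.
Qed.

Lemma apery_exists s : s \in S -> exists2 w, is_apery w & sim s w.
Proof.
move=> /base_exists[w [Aw [c ->]]]; exists w => //.
by exists (fun=> 0%N), c; rewrite cmb0 addm0.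
Qed.

(** * The staircase of normal exponents *)

Section TwoGenerators.
Variables b c : 'X_{1..d}.
Hypotheses (Sb : b \in S) (Sc : c \in S).
Hypothesis apery_gen : forall w, is_apery w -> exists l m, w = (b *+ l + c *+ m)%MM.

Definition pt l m := (b *+ l + c *+ m)%MM.

Lemma ptD l m l' m' : pt (l + l') (m + m') = (pt l m + pt l' m')%MM.
Proof. by apply/mnmP => i; rewrite /pt !mnmDE !mulmnE; lia. Qed.

Lemma ptSl l m : pt l.+1 m = (pt l m + b)%MM.
Proof. by apply/mnmP => i; rewrite /pt !mnmDE !mulmnE; lia. Qed.

Lemma ptSr l m : pt l m.+1 = (pt l m + c)%MM.
Proof. by apply/mnmP => i; rewrite /pt !mnmDE !mulmnE; lia. Qed.

Lemma pt_in l m : pt l m \in S.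
Proof. by apply: semigroupD; exact: affine_semigroupMn. Qed.

(* Exponents [(l, m)], lexicographically minimal among those giving the same
   element of the Apery set; they form an order ideal of [N^2] that is a
   fundamental domain for a lattice, hence an L-shape. *)
Definition normal l m := is_apery (pt l m) /\
  forall l' m', pt l' m' = pt l m -> (l < l')%N \/ l = l' /\ (m <= m')%N.

Lemma normal_exists w : is_apery w -> exists l m, normal l m /\ w = pt l m.
Proof.
move=> Aw; have [l0 [m0 wE]] := apery_gen Aw.
have exl : exists l, `[< exists m, w = pt l m >] by exists l0; apply/asboolP; exists m0.
case: (ex_minnP exl) => l /asboolP[m1 wE1] lmin.
have exm : exists m, w == pt l m by exists m1; apply/eqP.
case: (ex_minnP exm) => m /eqP wE2 mmin.
exists l, m; split=> //; split; first by rewrite -wE2.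
move=> l' m'; rewrite -wE2 => E.
have := lmin l'; rewrite leq_eqVlt => /(_ _)/orP[|/eqP ll'|]; last by left.
  by apply/asboolP; exists m'.
by right; split=> //; apply: mmin; rewrite ll' E.
Qed.

(** Shifting by [(l - l', m - m')] carries a pair representing [pt l' m'] and preceding [(l', m')]
    to one representing [pt l m] and preceding [(l, m)]. *)
Lemma normal_down l m l' m' :
  normal l m -> (l' <= l)%N -> (m' <= m)%N -> normal l' m'.
Proof.
move=> [[Sp Ap] lexp] ll mm.
have E : pt l m = (pt l' m' + pt (l - l') (m - m'))%MM by rewrite -ptD !subnKC.
split.
  split; first exact: pt_in.
  move=> i x Sx xE; apply: (Ap i (x + pt (l - l') (m - m'))%MM).
    by apply: semigroupD => //; exact: pt_in.
  by apply/mnmP => k; rewrite E xE !mnmDE; lia.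
move=> a a' aE; have := lexp (a + (l - l'))%N (a' + (m - m'))%N.
by rewrite ptD aE -E => /(_ erefl); lia.
Qed.

Lemma normal_inj l m l' m' :
  normal l m -> normal l' m' -> sim (pt l m) (pt l' m') -> l = l' /\ m = m'.
Proof.
move=> [Ap lexp] [Ap' lexp'] /(apery_sim Ap Ap') E.
by have := lexp _ _ (esym E); have := lexp' _ _ E; lia.
Qed.

(** The point [(l.+1, m.+1)] is then an inner corner of the staircase: a minimal point outside the
    order ideal, off both axes. *)
Definition mixed l m :=
  [/\ ~ normal l.+1 m.+1, normal l m.+1 & normal l.+1 m].

(** Let [(l0, m0)] be the normal pair congruent to [(l.+1, m.+1)]. If [l0 > 0], cancelling [b] makes
    [(l0 - 1, m0)] congruent, hence equal, to the normal pair [(l, m.+1)], and [(l.+1, m.+1)] would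
    be normal. Cancelling [c] excludes [m0 > 0]. *)
Lemma mixed_sim0 l m : mixed l m -> sim (pt l.+1 m.+1) 0%MM.
Proof.
move=> [nN N1 N2]; have [w Aw sw] := apery_exists (pt_in l.+1 m.+1).
have [l0 [m0 [N0 wE]]] := normal_exists Aw; rewrite wE in sw.
case: l0 m0 N0 sw {wE} => [|l0] m0 N0 sw; last first.
  move: sw; rewrite !ptSl => /sim_cancel.
  move=> /(normal_inj N1 (normal_down N0 (leqnSn _) (leqnn _)))[E1 E2].
  by case: nN; rewrite E1 E2.
case: m0 N0 sw => [|m0] N0 sw; last first.
  move: sw; rewrite !ptSr => /sim_cancel.
  by move=> /(normal_inj N2 (normal_down N0 (leqnn _) (leqnSn _)))[].
by have <- : pt 0 0 = 0%MM by rewrite /pt !mulm0n addm0.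
Qed.

(** Both inner corners are congruent to 0. Subtracting their common part [(l.+1, m'.+1)] leaves the
    congruent normal points [(l' - l, 0)] and [(0, m - m')], which would have to coincide. *)
Lemma mixed_unique l m l' m' : mixed l m -> mixed l' m' -> (l < l')%N -> False.
Proof.
move=> M M' ll'; have [nN N1 N2] := M; have [nN' N1' N2'] := M'.
have mm' : (m' < m)%N.
  by rewrite ltnNge; apply/negP => mm; apply: nN; apply: normal_down N1' _ _; lia.
have := sim_trans (mixed_sim0 M') (sim_sym (mixed_sim0 M)).
have -> : pt l'.+1 m'.+1 = (pt (l' - l) 0 + pt l.+1 m'.+1)%MM.
  by rewrite -ptD; congr pt; lia.
have -> : pt l.+1 m.+1 = (pt 0 (m - m') + pt l.+1 m'.+1)%MM.
  by rewrite -ptD; congr pt; lia.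
move=> /sim_cancel/normal_inj[||]; last by lia.
  by apply: normal_down N1' _ _; lia.
by apply: normal_down N2 _ _; lia.
Qed.

Definition corner l m := [/\ normal l m, ~ normal l.+1 m & ~ normal l m.+1].

(** In column [l.+1] the lowest point outside the order ideal has height above [m'], since
    [(l', m')] is inside, and at most [m], since [(l.+1, m)] is outside; it is the inner corner. *)
Lemma corner_mixed l m l' m' : corner l m -> corner l' m' -> (l < l')%N ->
  exists2 y, mixed l y & (m' <= y)%N.
Proof.
move=> [N1 N2 N3] [N1' N2' N3'] ll'.
have ex : exists y, `[< ~ normal l.+1 y >] by exists m; apply/asboolP.
case: (ex_minnP ex) => y /asboolP Ny ymin.
have ym : (y <= m)%N by apply: ymin; apply/asboolP.
have m'y : (m' < y)%N.
  by rewrite ltnNge; apply/negP => h; apply: Ny; apply: normal_down N1' _ _.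
case: y Ny ymin ym m'y => // y Ny ymin ym m'y; exists y => //; split => //.
  exact: normal_down N1 _ _.
by apply: contrapT => /asboolP/ymin; rewrite ltnn.
Qed.

Lemma corner_neq l m l' m' : corner l m -> corner l' m' -> l = l' -> m = m'.
Proof.
move=> [N1 N2 N3] [N1' N2' N3'] ll'; subst l'.
case: (ltngtP m m') => // h; exfalso.
  by apply: N3; apply: normal_down N1' _ _.
by apply: N3'; apply: normal_down N1 _ _.
Qed.

Lemma no_three_corners l1 m1 l2 m2 l3 m3 :
  corner l1 m1 -> corner l2 m2 -> corner l3 m3 -> (l1 < l2)%N -> (l2 < l3)%N -> False.
Proof.
move=> c1 c2 c3 l12 l23.
have [y M _] := corner_mixed c1 c2 l12; have [y' M' _] := corner_mixed c2 c3 l23.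
exact: mixed_unique M M' l12.
Qed.

Definition is_max w := is_apery w /\
  forall s, s \in S -> is_apery (w + s)%MM -> (w + s)%MM = w.

(** If [(l.+1, m)] were normal, maximality would give [w + b = w], and [(l, m)] would be a smaller
    pair for the same element. The same holds for [c]. *)
Lemma max_corner w : is_max w -> exists l m, corner l m /\ w = pt l m.
Proof.
move=> [Aw mw]; have [l [m [N wE]]] := normal_exists Aw.
exists l, m; split=> //; split => // -[A lex].
- have E : pt l.+1 m = w by rewrite ptSl -wE mw // wE -ptSl.
  by have := lex l m; rewrite E -wE => /(_ erefl); lia.
- have E : pt l m.+1 = w by rewrite ptSr -wE mw // wE -ptSr.
  by have := lex l m; rewrite E -wE => /(_ erefl); lia.
Qed.

Lemma max_le2 w1 w2 w3 : is_max w1 -> is_max w2 -> is_max w3 ->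
  [\/ w1 = w2, w1 = w3 | w2 = w3].
Proof.
move=> /max_corner[l1 [m1 [c1 ->]]] /max_corner[l2 [m2 [c2 ->]]].
move=> /max_corner[l3 [m3 [c3 ->]]].
case: (ltngtP l1 l2) => [l12|l12|l12]; last first.
- by rewrite (corner_neq c1 c2 l12) l12; constructor 1.
- case: (ltngtP l1 l3) => [l13|l13|l13].
  + by case: (no_three_corners c2 c1 c3 l12 l13).
  + case: (ltngtP l2 l3) => [l23|l23|l23].
    * by case: (no_three_corners c2 c3 c1 l23 l13).
    * by case: (no_three_corners c3 c2 c1 l23 l12).
    * by rewrite (corner_neq c2 c3 l23) l23; constructor 3.
  + by rewrite (corner_neq c1 c3 l13) l13; constructor 2.
case: (ltngtP l2 l3) => [l23|l23|l23].
- by case: (no_three_corners c1 c2 c3 l12 l23).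
- case: (ltngtP l1 l3) => [l13|l13|l13].
  + by case: (no_three_corners c1 c3 c2 l13 l23).
  + by case: (no_three_corners c3 c1 c2 l13 l12).
  + by rewrite (corner_neq c1 c3 l13) l13; constructor 2.
- by rewrite (corner_neq c2 c3 l23) l23; constructor 3.
Qed.

End TwoGenerators.
End Apery.

(** * Height and depth of the monomial maximal ideal *)

Section SemigroupRingDepth.
Variables (d : nat) (K : fieldType) (S : affine_semigroup d).
Local Notation A := (semigroup_ring K S).

Local Notation vv := (@semigroup_ring_val d K S).

Lemma vv_inj : injective vv.
Proof. exact: val_inj. Qed.

Lemma val_sum (I : Type) (r : seq I) (F : I -> A) :
  vv (\sum_(i <- r) F i) = \sum_(i <- r) vv (F i).
Proof. exact: (rmorph_sum \val). Qed.

Lemma ring_valD (p q : A) : vv (p + q) = vv p + vv q.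
Proof. exact: (rmorphD \val). Qed.

Lemma ring_valB (p q : A) : vv (p - q) = vv p - vv q.
Proof. exact: (rmorphB \val). Qed.

Lemma ring_valM (p q : A) : vv (p * q) = vv p * vv q.
Proof. exact: (rmorphM \val). Qed.

Lemma ring_val0 : vv 0 = 0.
Proof. exact: (rmorph0 \val). Qed.

Lemma ring_val1 : vv 1 = 1.
Proof. exact: (rmorph1 \val). Qed.

Lemma in_semigroup_alg (p : A) m : m \in msupp (vv p) -> m \in S.
Proof. by case: p => p /= /allP; apply. Qed.

(** The default 0 of [insubd] never occurs for constants, and occurs for [mono m] only when [m] is
    outside [S]. *)
Definition cst (c : K) : A := insubd 0 c%:MP.
Definition mono m : A := insubd 0 'X_[m].

Lemma val_cst c : vv (cst c) = c%:MP.
Proof.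
apply: insubdK; rewrite inE msuppC; case: eqP => //= _.
by rewrite semigroup0.
Qed.

Lemma val_mono m : m \in S -> vv (mono m) = 'X_[m].
Proof. by move=> Sm; apply: insubdK; rewrite inE msuppX /= Sm. Qed.

Lemma monoD m m' : m \in S -> m' \in S -> mono (m + m')%MM = mono m * mono m'.
Proof.
move=> Sm Sm'; apply: vv_inj; rewrite ring_valM !val_mono ?mpolyXD //.
exact: semigroupD.
Qed.

Lemma semigroup_ringE (p : A) :
  p = \sum_(m <- msupp (vv p)) cst (vv p)@_m * mono m.
Proof.
apply: vv_inj; rewrite val_sum [LHS]mpolyE.
rewrite big_seq [RHS]big_seq; apply: eq_bigr => m mp.
by rewrite ring_valM val_cst val_mono ?mul_mpolyC // (in_semigroup_alg mp).
Qed.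

Variables (e : 'I_d -> 'X_{1..d}) (co : 'X_{1..d} -> 'I_d -> rat).
Hypotheses (eS : forall i, e i \in S) (e_neq0 : forall i, e i != 0%MM).
Hypothesis coD : forall m m' i, co (m + m')%MM i = co m i + co m' i.
Hypothesis co_ge0 : forall m i, m \in S -> 0 <= co m i.
Hypothesis co_eq0 : forall m, (forall i, co m i = 0) -> m = 0%MM.
Hypothesis co_e : forall i j, j != i -> co (e i) j = 0.
Hypothesis e_radical : forall m, m \in S -> m != 0%MM ->
  exists k i m', m' \in S /\ (m *+ k = m' + e i)%MM.

(** As [co] is nonnegative on [S], this cuts out a face of the cone; the faces shrink from
    everything at [k = 0] to zero at [k = d]. *)
Definition face k m := [forall j : 'I_d, (j < k)%N ==> (co m j == 0)].

Lemma faceD k m m' : m \in S -> m' \in S ->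
  face k (m + m')%MM = face k m && face k m'.
Proof.
move=> Sm Sm'; apply/forallP/andP => [h|[/forallP h1 /forallP h2] j].
  split; apply/forallP => j; apply/implyP => jk;
  by have := implyP (h j) jk; rewrite coD paddr_eq0 ?co_ge0 // => /andP[].
apply/implyP => jk; rewrite coD.
by rewrite (eqP (implyP (h1 j) jk)) (eqP (implyP (h2 j) jk)) addr0.
Qed.

Lemma face0 k : face k 0%MM.
Proof.
apply/forallP => j; apply/implyP => _; apply/eqP.
by have := coD 0%MM 0%MM j; rewrite addm0; lra.
Qed.

Definition off_face k : {pred A} :=
  [pred p : A | all (fun m => ~~ face k m) (msupp (vv p))].

Lemma off_faceP k (p : A) :
  reflect (forall m, face k m -> (vv p)@_m = 0) (p \in off_face k).
Proof.
apply: (iffP allP) => [h m fm|h m].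
  by apply: memN_msupp_eq0; apply/negP => /h; rewrite fm.
by rewrite mcoeff_msupp; apply: contra => /h ->.
Qed.

Lemma off_face_ideal k : idealr_closed (off_face k).
Proof.
split.
- by rewrite inE ring_val0 msupp0.
- by rewrite inE ring_val1 msupp1 /= face0.
move=> a u v /allP hu /allP hv; apply/allP => m.
rewrite ring_valD ring_valM => /msuppD_le; rewrite mem_cat => /orP[|/hv //].
move=> /msuppM_le/allpairsP[[m1 m2] /= [am um ->]].
by rewrite faceD ?(in_semigroup_alg am) ?(in_semigroup_alg um) // negb_and (hu _ um) orbT.
Qed.

Definition on_face k (p : {mpoly K[d]}) : {mpoly K[d]} :=
  \sum_(m <- msupp p | face k m) p@_m *: 'X_[m].

Lemma mcoeff_on_face k p m : (on_face k p)@_m = if face k m then p@_m else 0.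
Proof.
rewrite raddf_sum /=; under eq_bigr => m' _ do rewrite mcoeffZ mcoeffX.
case: ifP => fm; last first.
  rewrite big1 // => m' fm'; case: eqP => [E|_]; last by rewrite mulr0.
  by rewrite -E fm' in fm.
have [mp|mp] := boolP (m \in msupp p).
  rewrite big_mkcond /= (bigD1_seq m) //= ?msupp_uniq // fm eqxx mulr1.
  rewrite big1 ?addr0 // => m' /negbTE->.
  by rewrite mulr0 if_same.
rewrite big_seq_cond big1 ?memN_msupp_eq0 // => m' /andP[mp' _].
by case: eqP => [E|_]; [rewrite -E mp' in mp | rewrite mulr0].
Qed.

(** By [faceD], [on_face k] is multiplicative on [K[S]]; its values lie in the domain of all
    polynomials, and [off_face k] is its kernel. *)
Lemma off_face_prime k : prime_ideal (off_face k).
Proof.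
split; first exact: off_face_ideal.
move=> u v /off_faceP uv.
have Nu (w : A) m : m \notin S -> (vv w)@_m = 0.
  by move=> mS; apply: memN_msupp_eq0; apply: contra mS; exact: in_semigroup_alg.
have uv0 : on_face k (vv u) * on_face k (vv v) = 0.
  apply/mpolyP => m; rewrite mcoeff0; have [fm|fm] := boolP (face k m).
    rewrite -(uv m fm) ring_valM !mcoeffM; apply: eq_bigr => -[[m1 /= ?] [m2 /= ?]] /= /eqP mE.
    rewrite !mcoeff_on_face.
    have [S1|/Nu->] := boolP (m1 \in S); last by rewrite if_same !mul0r.
    have [S2|/Nu->] := boolP (m2 \in S); last by rewrite if_same !mulr0.
    by move: fm; rewrite mE faceD // => /andP[-> ->].
  rewrite mcoeffM big1 // => -[[m1 /= ?] [m2 /= ?]] /= /eqP mE.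
  rewrite !mcoeff_on_face.
  have [S1|/Nu->] := boolP (m1 \in S); last by rewrite if_same !mul0r.
  have [S2|/Nu->] := boolP (m2 \in S); last by rewrite if_same !mulr0.
  move: fm; rewrite mE faceD // negb_and => /orP[/negbTE->|/negbTE->].
    by rewrite mul0r.
  by rewrite mulr0.
have on0 (w : A) : on_face k (vv w) = 0 -> w \in off_face k.
  by move=> w0; apply/off_faceP => m fm; have := mcoeff_on_face k (vv w) m; rewrite w0 fm mcoeff0.
by move/eqP: uv0; rewrite mulf_eq0 => /orP[] /eqP/on0 ->; rewrite ?orbT.
Qed.

Lemma face_top m : face d m -> m = 0%MM.
Proof. by move=> /forallP h; apply: co_eq0 => i; have /implyP/(_ (ltn_ord i))/eqP := h i. Qed.

(** An element of [I] with constant term [a != 0] differs from [a] by an element of [off_face d], so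
    [I] would contain a unit. *)
Lemma off_face_maximal : maximal_ideal (off_face d).
Proof.
split; first exact: off_face_ideal.
move=> I [I0 I1 Ilin] sub x Ix; apply: contrapT => /negP nx.
have [x0|x0] := eqVneq ((vv x)@_0%MM) 0.
  by case/negP: nx; apply/off_faceP => m /face_top ->.
set a := (vv x)@_0%MM in x0.
have yI : x - cst a \in I.
  apply: sub; apply/off_faceP => m /face_top ->.
  by rewrite ring_valB mcoeffB val_cst mcoeffC eqxx mulr1 subrr.
have cI : cst a \in I.
  have := Ilin (-1) _ _ yI Ix; by rewrite mulN1r opprB subrK.
have := Ilin (cst a^-1) _ _ cI I0; rewrite addr0.
have -> : cst a^-1 * cst a = 1.
  by apply: vv_inj; rewrite ring_valM ring_val1 !val_cst -mpolyCM mulVf.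
by move=> h; rewrite h in I1.
Qed.

Lemma off_face_chain : prime_chain (off_face d) d off_face.
Proof.
split=> // [i _|i id]; first exact: off_face_prime.
have faceS m : face i.+1 m -> face i m.
  move=> /forallP h; apply/forallP => j; apply/implyP => ji.
  by apply: (implyP (h j)); exact: ltnW.
split=> [p /off_faceP h|h].
  by apply/off_faceP => m /faceS/h.
(* Strictness: [e i] has only its coordinate [i] nonzero, which [face i.+1] tests and [face i] does
   not. *)
have := h (mono (e (Ordinal id))); set i' := Ordinal id.
have c0 : co (e i') i' != 0.
  apply: contra (e_neq0 i') => /eqP c0; apply/eqP/co_eq0 => j.
  by have [->|/co_e] := eqVneq j i'.
rewrite !inE val_mono // msuppX /= !andbT => /(_ _)/negP[].
  by apply/negP => /forallP/(_ i'); rewrite /= ltnSn /= (negbTE c0).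
apply/forallP => j; apply/implyP => ji; apply/eqP/co_e.
by apply: contraTneq ji => ->; rewrite ltnn.
Qed.

Lemma regular_seq_exists : cohen_macaulay A ->
  exists xs : seq A,
    [/\ (d <= size xs)%N, {subset xs <= off_face d} & regular_seq xs].
Proof.
move=> [_ /(_ _ off_face_maximal)[n [[[xs [sz sub reg]] _] [_ ht]]]].
by exists xs; split=> //; rewrite sz; exact: ht off_face_chain.
Qed.

(** Extended by 0, since the Koszul complex takes a family indexed by [nat]. *)
Definition gens k : A := if insub k is Some i then mono (e i) else 0.

Lemma gensE (i : 'I_d) : gens i = mono (e i).
Proof. by rewrite /gens valK. Qed.

Let J (x : A) := exists c : nat -> A, x = \sum_(j < d) c j * gens j.

Let J_ideal : is_ideal J.
Proof.
split; first by exists (fun=> 0); rewrite big1 // => i _; rewrite mul0r.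
move=> a x y [c ->] [c' ->]; exists (fun i => a * c i + c' i).
rewrite mulr_sumr -big_split /=; apply: eq_bigr => i _.
by rewrite mulrDl mulrA.
Qed.

Let JM a x : J x -> J (a * x).
Proof. by move=> Jx; rewrite -[_ * _]addr0; apply: J_ideal.2 => //; exact: J_ideal.1. Qed.

Let JD x y : J x -> J y -> J (x + y).
Proof. by move=> Jx Jy; rewrite -[x]mul1r; exact: J_ideal.2. Qed.

(** Elements with a power in [J] are closed under sums, which reduces the claim to monomials, where
    [e_radical] applies. *)
Lemma off_face_radical f : f \in off_face d ->
  exists N (c : nat -> A), f ^+ N = \sum_(j < d) c j * gens j.
Proof.
move=> /allP hf; suff : exists N, J (f ^+ N) by case=> N [c]; exists N, c.
rewrite (semigroup_ringE f) big_seq.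
elim/big_ind: _ => [|x y [N Nx] [M My]|m mf].
- by exists 1%N; rewrite expr1; exact: J_ideal.1.
- exists (N + M)%N; rewrite exprDn; elim/big_ind: _ => [|u v|i _].
  + exact: J_ideal.1.
  + exact: JD.
  rewrite -mulr_natl; apply: JM.
  (* Each term of the expansion of [(x + y) ^+ (N + M)] is divisible by [x ^+ N] or by [y ^+ M]. *)
  have [iM|Mi] := leqP M i.
    by rewrite -(subnK iM) [y ^+ _]exprD mulrA; apply: JM.
  have -> : (N + M - i = N + (M - i))%N by lia.
  by rewrite exprD -mulrA mulrC; apply: JM.
have Sm := in_semigroup_alg mf.
have m0 : m != 0%MM by apply: contra (hf _ mf) => /eqP ->; exact: face0.
have [k [i [m' [Sm' E]]]] := e_radical Sm m0.
exists k; rewrite exprMn; apply: JM.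
have -> : mono m ^+ k = mono m' * mono (e i).
  rewrite -monoD // -E; elim: k {E} => [|k IH].
    by apply: vv_inj; rewrite expr0 ring_val1 val_mono ?mulm0n ?mpolyX0 // semigroup0.
  by rewrite exprS IH mulmS monoD // affine_semigroupMn.
apply: JM; exists (fun j => (j == i :> nat)%:R); rewrite (bigD1 i) //= eqxx mul1r gensE.
by rewrite big1 ?addr0 // => j /negbTE; rewrite -val_eqE /= => ->; rewrite mul0r.
Qed.

(** If no edge left [U], the coefficient of [x^s] would vanish on multiples of [x^(e a + e b)] with
    [a] in [U] and [b] outside. Then [regular_cut], applied to the two factorizations of [x^s],
    would make the coefficient of [x^s] in itself zero. *)
Lemma cohen_macaulay_connected : cohen_macaulay A ->
  forall (U : pred 'I_d) s i j m m',
  U i -> ~~ U j -> m \in S -> m' \in S -> s = (m + e i)%MM -> s = (m' + e j)%MM ->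
  exists i' j' m'', [/\ U i', ~~ U j', m'' \in S & s = (m'' + e i' + e j')%MM].
Proof.
move=> /regular_seq_exists[xs [sz sub reg]] U s i j m m' Ui Uj Sm Sm' sE sE'.
apply: contrapT => nex.
pose UN k := if insub k is Some i then U i else false.
have UNE (l : 'I_d) : UN l = U l by rewrite /UN valK.
have ellU a b r : UN a -> ~~ UN b -> (mcoeff s \o \val) (gens a * gens b * r) = 0.
  rewrite /gens /UN; case: insubP => //= a' _ _ Ua.
  case: insubP => [b' _ _ Ub|_ _]; last by rewrite mulr0 mul0r raddf0.
  rewrite -[LHS]/((vv (mono (e a') * mono (e b') * r))@_s) !ring_valM !val_mono // -mpolyXD mulrC.
  apply: memN_msupp_eq0; apply/negP; rewrite (perm_mem (msuppMX _ _)) => /mapP[m'' mr sE''].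
  apply: nex; exists a', b', m''; split=> //; first exact: in_semigroup_alg mr.
  by rewrite sE'' addmC addmA.
have := regular_cut reg sz (fun f fx => off_face_radical (sub f fx)) ellU
  (p := mono m) (q := mono m') (ltn_ord i) (ltn_ord j).
rewrite !UNE !gensE -!monoD // addmC [(e j + _)%MM]addmC -sE -sE' => /(_ Ui Uj erefl) /eqP.
rewrite /= val_mono; last by rewrite sE; exact: semigroupD.
by rewrite mcoeffX eqxx oner_eq0.
Qed.

End SemigroupRingDepth.

(** * Extremal rays of a simplicial cone *)

Lemma generates_sub d (S : {pred 'X_{1..d}}) (B : {fset 'X_{1..d}}) a :
  generates B S -> a \in B -> a \in S.
Proof.
move=> genB aB; apply/genB; exists (fun x => (x == a)%N).
rewrite (big_fsetD1 a) //= eqxx big1_seq ?addm0 // => x /andP[_].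
by rewrite !inE => /andP[/negbTE -> _].
Qed.

Section Coordinates.
Variables (d : nat) (b : 'I_d -> 'X_{1..d}).

Definition ray_mx : 'M[rat]_d := \matrix_(i < d) mnm_vec rat (b i).

Hypothesis b_free : row_free ray_mx.

Definition coord m (i : 'I_d) : rat := (mnm_vec rat m *m invmx ray_mx) 0 i.

Lemma mnm_vecD (A : nzRingType) (m m' : 'X_{1..d}) :
  mnm_vec A (m + m')%MM = mnm_vec A m + mnm_vec A m'.
Proof. by apply/rowP => i; rewrite !mxE mnmDE natrD. Qed.

Lemma coordD m m' i : coord (m + m')%MM i = coord m i + coord m' i.
Proof. by rewrite /coord mnm_vecD mulmxDl mxE. Qed.

Lemma coord0 i : coord 0%MM i = 0.
Proof. by have := coordD 0%MM 0%MM i; rewrite addm0; lra. Qed.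

Lemma coordMn m k i : coord (m *+ k)%MM i = k%:R * coord m i.
Proof.
elim: k => [|k IH]; first by rewrite mulm0n coord0 mul0r.
by rewrite mulmS coordD IH -natr1 mulrDl mul1r addrC.
Qed.

Lemma coord_sum (I : Type) (r : seq I) (P : pred I) F i :
  coord (\sum_(j <- r | P j) F j)%MM i = \sum_(j <- r | P j) coord (F j) i.
Proof.
apply: (big_morph (fun m => coord m i)) => [x y|]; first exact: coordD.
exact: coord0.
Qed.

Lemma ray_mx_unit : ray_mx \in unitmx.
Proof. by rewrite -row_free_unit. Qed.

Lemma mnm_vecE m : mnm_vec rat m = \sum_i coord m i *: mnm_vec rat (b i).
Proof.
rewrite -[LHS](mulmxKV ray_mx_unit) mulmx_sum_row; apply: eq_bigr => i _.
by rewrite rowK.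
Qed.

Lemma coord_b i j : coord (b i) j = (i == j)%:R.
Proof.
have -> : coord (b i) j = (row i ray_mx *m invmx ray_mx) 0 j by rewrite rowK.
by rewrite -row_mul mulmxV ?ray_mx_unit // !mxE.
Qed.

Lemma coord_inj m m' : (forall i, coord m i = coord m' i) -> m = m'.
Proof.
move=> h; have /rowP E : mnm_vec rat m = mnm_vec rat m'.
  by rewrite !mnm_vecE; apply: eq_bigr => i _; rewrite h.
by apply/mnmP => i; have /eqP := E i; rewrite !mxE eqr_nat => /eqP.
Qed.

Lemma coord_eq0 m : (forall i, coord m i = 0) -> m = 0%MM.
Proof. by move=> h; apply: coord_inj => i; rewrite h coord0. Qed.

Variable S : affine_semigroup d.
Hypothesis Sb : forall i, b i \in S.
Hypothesis b_radical : forall a, a \in S -> exists n : nat, (0 < n)%N /\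
  exists c : 'I_d -> nat, (a *+ n = \sum_(i < d) b i *+ c i)%MM.

Lemma coord_radical a : a \in S -> exists2 n : nat, (0 < n)%N &
  exists2 c : 'I_d -> nat, (a *+ n = \sum_(i < d) b i *+ c i)%MM
    & forall i, n%:R * coord a i = (c i)%:R.
Proof.
move=> /b_radical[n [n0 [c E]]]; exists n => //; exists c => // i.
rewrite -coordMn E coord_sum (bigD1 i) //= coordMn coord_b eqxx mulr1.
by rewrite big1 ?addr0 // => j /negbTE ji; rewrite coordMn coord_b ji mulr0.
Qed.

Lemma coord_ge0 a i : a \in S -> 0 <= coord a i.
Proof.
move=> /coord_radical[n n0 [c _ /(_ i) E]].
by rewrite -(pmulr_rge0 _ (_ : 0 < n%:R :> rat)) ?ltr0n // E.
Qed.

Definition on_ray i m := forall j, j != i -> coord m j = 0.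

Lemma on_ray_coord_gt0 i m : m \in S -> m != 0%MM -> on_ray i m -> 0 < coord m i.
Proof.
move=> Sm m0 rm; rewrite lt_def coord_ge0 // andbT; apply: contra m0 => /eqP c0.
by apply/eqP/coord_eq0 => j; have [->|/rm] := eqVneq j i.
Qed.

Lemma on_ray_proportional i m m' : on_ray i m -> on_ray i m' -> coord m i != 0 ->
  forall k, (m' k)%:R = coord m' i / coord m i * (m k)%:R :> rat.
Proof.
move=> rm rm' c0 k.
have vE x : on_ray i x -> (x k)%:R = coord x i * (b i k)%:R :> rat.
  move=> rx; have /rowP/(_ k) := mnm_vecE x; rewrite !mxE => ->.
  rewrite summxE (bigD1 i) //= !mxE big1 ?addr0 // => j /rx ->.
  by rewrite scale0r mxE.
by rewrite (vE m rm) (vE m' rm'); field.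
Qed.

(* The elements [b i] need not be extremal rays: for [S = <2, 3>] one may have
   [b = 3], whereas the extremal ray is [2]. *)
Lemma smallest_on_ray i : exists e, [/\ e \in S, e != 0%MM, on_ray i e
  & forall m, m \in S -> m != 0%MM -> on_ray i m -> (e <= m)%MM].
Proof.
have ex : exists k, `[< exists m, [/\ m \in S, m != 0%MM, on_ray i m & mdeg m = k] >].
  exists (mdeg (b i)); apply/asboolP; exists (b i); split=> //.
    apply: contra_eq_neq (coord_b i i) => ->.
    by rewrite coord0 eqxx eq_sym oner_eq0.
  by move=> j ji; rewrite coord_b eq_sym (negbTE ji).
case: (ex_minnP ex) => k /asboolP[e [Se e0 re ek]] kmin.
exists e; split=> // m Sm m0 rm.
have me : (mdeg e <= mdeg m)%N by rewrite ek; apply: kmin; apply/asboolP; exists m.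
have ce := on_ray_coord_gt0 Se e0 re.
have prop := on_ray_proportional re rm (lt0r_neq0 ce).
(* Here [m] is [t] times [e]; minimality of the degree of [e] gives [1 <= t], hence [e <= m]. *)
set t := coord m i / coord e i in prop.
have tdeg : (mdeg m)%:R = t * (mdeg e)%:R :> rat.
  by rewrite !mdegE !natr_sum mulr_sumr; apply: eq_bigr => l _.
have e_gt0 : 0 < (mdeg e)%:R :> rat by rewrite ltr0n lt0n mdeg_eq0.
have t1 : 1 <= t.
  by rewrite -(ler_pM2r e_gt0) mul1r -tdeg ler_nat.
apply/mnm_lepP => l; rewrite -(ler_nat rat) prop.
by rewrite ler_peMl // ler0n.
Qed.

Variable e : 'I_d -> 'X_{1..d}.
Hypothesis eP : forall i, [/\ e i \in S, e i != 0%MM, on_ray i (e i)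
  & forall m, m \in S -> m != 0%MM -> on_ray i m -> (e i <= m)%MM].

Lemma e_inj : injective e.
Proof.
move=> i j E; apply/eqP; apply: contraT => ij; rewrite eq_sym in ij.
have [Se e0 re _] := eP i; have [_ _ re' _] := eP j.
have := on_ray_coord_gt0 Se e0 re.
by rewrite E re' ?ltxx // eq_sym.
Qed.

Lemma smallest_radical m : m \in S -> m != 0%MM ->
  exists k i m', m' \in S /\ (m *+ k = m' + e i)%MM.
Proof.
move=> Sm m0.
have [i ci] : exists i, coord m i != 0.
  apply: contrapT => /forallNP h; case/negP: m0; apply/eqP/coord_eq0 => i.
  by apply/eqP; apply: contrapT => /negP/h.
have [n n0 [c E cE]] := coord_radical Sm.
have c_i : (0 < c i)%N.
  by rewrite lt0n -(eqr_nat rat) -cE mulf_neq0 // pnatr_eq0 -lt0n.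
have [Se e0 re _] := eP i.
have [n' n'0 [c' E' cE']] := coord_radical Se.
have {}E' : (e i *+ n' = b i *+ c' i)%MM.
  apply: coord_inj => j; rewrite !coordMn coord_b.
  have [->|ji] := eqVneq j i; first by rewrite cE' ?eqxx mulr1.
  by rewrite re // !mulr0.
(* Multiplying [m *+ n] by [c' i] turns its [b i] part into [e i *+ (n' * c i)], a positive multiple
   from which one [e i] is split off. *)
exists (n * c' i)%N, i, (e i *+ (n' * c i).-1 + \sum_(j < d | j != i) b j *+ (c j * c' i))%MM.
split.
  apply: semigroupD; first exact: affine_semigroupMn.
  elim/big_ind: _ => [|x y|j _]; first exact: semigroup0.
    exact: semigroupD.
  exact: affine_semigroupMn.
apply/mnmP => k; move/mnmP/(_ k): E; move/mnmP/(_ k): E'.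
rewrite (bigD1 i) //= !mnmDE !mulmnE !mnm_sumE => E' E.
have X0 : (0 < n' * c i)%N by rewrite muln_gt0 n'0.
rewrite addnAC -mulnSr (prednK X0) mulnA E mulnDl mulnAC -E' mulnA; congr (_ + _)%N.
by rewrite big_distrl /=; apply: eq_bigr => j _; rewrite !mulmnE mulnA.
Qed.

(** A nonzero generator [a] occurring in [e i] satisfies [a <= e i] and, coordinates being
    nonnegative, lies on the same ray, so [e i <= a]. *)
Lemma generates_smallest (A : {fset 'X_{1..d}}) i : generates A S -> e i \in A.
Proof.
move=> genA; have [Se e0 re emin] := eP i.
have SA a : a \in A -> a \in S by exact: generates_sub.
have [c eE] := (genA (e i)).1 Se.
have [a [aA a0 ca]] : exists a, [/\ a \in A, a != 0%MM & (0 < c a)%N].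
  apply: contrapT => h; case/negP: e0; rewrite eE; apply/eqP.
  rewrite big_seq big1 // => a aA.
  have [->|a0] := eqVneq a 0%MM.
    by apply/mnmP => k; rewrite mulmnE mnm0E.
  have [->|ca] := posnP (c a); first exact: mulm0n.
  by case: h; exists a.
have ae : (a <= e i)%MM.
  rewrite eE (big_fsetD1 a) //= -(prednK ca) mulmS -addmA.
  exact: lem_addr.
have ra : on_ray i a.
  move=> j ji; have := re j ji; rewrite eE coord_sum big_seq.
  have nn x : x \in A -> 0 <= coord (x *+ c x)%MM j.
    by move=> /SA Sx; apply: coord_ge0; exact: affine_semigroupMn.
  move=> /eqP; rewrite psumr_eq0 // => /allP/(_ a aA); rewrite aA coordMn.
  by rewrite mulf_eq0 pnatr_eq0 eqn0Ngt ca => /eqP.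
suff <- : a = e i by [].
have ea := emin a (SA a aA) a0 ra.
apply/mnmP => k; apply/eqP; rewrite eqn_leq.
by rewrite (mnm_lepP ae) (mnm_lepP ea).
Qed.

Section RealCone.
Variable R : realType.

Let BR := map_mx (ratr : rat -> R) ray_mx.

Definition rcoord (x : 'rV[R]_d) i : R := (x *m invmx BR) 0 i.

Lemma rcoordD x y i : rcoord (x + y) i = rcoord x i + rcoord y i.
Proof. by rewrite /rcoord mulmxDl mxE. Qed.

Lemma rcoordZ t x i : rcoord (t *: x) i = t * rcoord x i.
Proof. by rewrite /rcoord -scalemxAl mxE. Qed.

Lemma rcoord_vec m i : rcoord (mnm_vec R m) i = ratr (coord m i).
Proof.
have -> : mnm_vec R m = map_mx ratr (mnm_vec rat m).
  by apply/rowP => k; rewrite !mxE ratr_nat.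
by rewrite /rcoord -map_invmx -map_mxM mxE.
Qed.

Lemma rvecE x : x = \sum_i rcoord x i *: mnm_vec R (b i).
Proof.
have uB : BR \in unitmx by rewrite map_unitmx ray_mx_unit.
rewrite -[LHS](mulmxKV uB) mulmx_sum_row; apply: eq_bigr => i _.
by congr (_ *: _); apply/rowP => k; rewrite !mxE ratr_nat.
Qed.

Lemma rcoord_inj x y : (forall i, rcoord x i = rcoord y i) -> x = y.
Proof. by move=> h; rewrite [x]rvecE [y]rvecE; apply: eq_bigr => i _; rewrite h. Qed.

Lemma cone_rcoord x i : cone S x -> 0 <= rcoord x i.
Proof.
move=> [n [s [c [Ss c0 ->]]]].
have -> : rcoord (\sum_(j < n) c j *: mnm_vec R (s j)) i =
    \sum_(j < n) c j * ratr (coord (s j) i).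
  rewrite /rcoord mulmx_suml summxE; apply: eq_bigr => j _.
  by rewrite -scalemxAl mxE; congr (_ * _); exact: rcoord_vec.
by apply: sumr_ge0 => j _; rewrite mulr_ge0 // ler0q coord_ge0.
Qed.

Lemma cone_vec m t : m \in S -> 0 <= t -> cone S (t *: mnm_vec R m).
Proof.
by move=> Sm t0; exists 1%N, (fun=> m), (fun=> t); split; rewrite ?big_ord1.
Qed.

Lemma cone_sum (P : pred 'I_d) (t : 'I_d -> R) : (forall i, 0 <= t i) ->
  cone S (\sum_(i | P i) t i *: mnm_vec R (b i)).
Proof.
move=> t0; exists d, b, (fun i => if P i then t i else 0); split=> // [i|].
  by case: ifP.
rewrite big_mkcond; apply: eq_bigr => i _; case: ifP => // _.
by rewrite scale0r.
Qed.

Lemma ray_on_ray i m : m \in S -> ray (mnm_vec R (e i)) (mnm_vec R m) -> on_ray i m.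
Proof.
move=> Sm [t t0 E] j ji; have [_ _ re _] := eP i.
have /eqP := rcoord_vec m j; rewrite E rcoordZ rcoord_vec re // rmorph0 mulr0.
by rewrite eq_sym fmorph_eq0 => /eqP.
Qed.

Lemma extremal_rayP a : extremal_ray R S a <-> exists i, a = e i.
Proof.
split=> [[Sa [a0 _ face] amin]|[i ->]].
  have [i ci] : exists i, coord a i != 0.
    apply: contrapT => /forallNP h; case/negP: a0; apply/eqP/rcoord_inj => i.
    rewrite rcoord_vec (_ : coord a i = 0); last by apply/eqP; apply: contrapT => /negP/h.
    by rewrite rmorph0 /rcoord mul0mx mxE.
  have ra0 j : 0 <= rcoord (mnm_vec R a) j by rewrite rcoord_vec ler0q coord_ge0.
  (* Split [a] into its [b i] component and the rest, both in the cone. Extremality makes this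
     nonzero component proportional to [a], so [a] lies on ray [i]. *)
  have [] := face (rcoord (mnm_vec R a) i *: mnm_vec R (b i))
    (\sum_(j | j != i) rcoord (mnm_vec R a) j *: mnm_vec R (b j)).
  - exact: cone_vec.
  - exact: cone_sum.
  - by exists 1 => //; rewrite scale1r [RHS]rvecE [RHS](bigD1 i).
  move=> [t t0 E] _.
  have t_neq0 : t != 0.
    apply: contra_eq_neq E => ->; rewrite scale0r.
    apply/eqP => /(congr1 (rcoord^~ i)).
    rewrite rcoordZ !rcoord_vec coord_b eqxx rmorph1 mulr1 /rcoord mul0mx mxE => /eqP.
    by rewrite fmorph_eq0 (negbTE ci).
  have ra : on_ray i a.
    move=> j ji; move/(congr1 (rcoord^~ j)): E.
    rewrite !rcoordZ !rcoord_vec coord_b eq_sym (negbTE ji) rmorph0 mulr0 => /esym/eqP.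
    by rewrite mulf_eq0 (negbTE t_neq0) fmorph_eq0 => /eqP.
  have a_neq0 : a != 0%MM.
    by apply: contra ci => /eqP ->; rewrite coord0.
  have [Se e0 re emin] := eP i.
  have ea := emin a Sa a_neq0 ra.
  have ae : (a <= e i)%MM.
    apply: amin => //; exists (ratr (coord (e i) i / coord a i)).
      by rewrite ler0q divr_ge0 ?coord_ge0.
    apply/rowP => k; rewrite !mxE -!(ratr_nat R) -rmorphM /=.
    by rewrite -(on_ray_proportional ra re ci).
  exists i; apply/mnmP => k; apply/eqP; rewrite eqn_leq.
  by rewrite (mnm_lepP ae) (mnm_lepP ea).
have [Se e0 re emin] := eP i.
have ce := on_ray_coord_gt0 Se e0 re.
have rce : rcoord (mnm_vec R (e i)) i != 0 by rewrite rcoord_vec fmorph_eq0 gt_eqF.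
split=> //; last by move=> m Sm m0 /(ray_on_ray Sm) rm; exact: emin.
split.
- apply: contraNneq rce => ->; by rewrite /rcoord mul0mx mxE.
- by rewrite -[mnm_vec _ _]scale1r; exact: cone_vec.
move=> x y Cx Cy [t t0 xy].
(* Off [i] the coordinates of [z] and [z'] are nonnegative with sum zero, so they vanish. *)
have main (z z' : 'rV[R]_d) : cone S z -> cone S z' -> z + z' = t *: mnm_vec R (e i) ->
    ray (mnm_vec R (e i)) z.
  move=> Cz Cz' E; exists (rcoord z i / rcoord (mnm_vec R (e i)) i).
    by apply: divr_ge0; [exact: cone_rcoord | rewrite rcoord_vec ler0q ltW].
  apply: rcoord_inj => j; rewrite rcoordZ; have [->|ji] := eqVneq j i.
    by rewrite divfK.
  rewrite (rcoord_vec _ j) re // rmorph0 mulr0; apply/eqP.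
  move/(congr1 (rcoord^~ j)): E; rewrite rcoordD rcoordZ rcoord_vec re // rmorph0 mulr0 => /eqP.
  by rewrite paddr_eq0 ?cone_rcoord // => /andP[].
by split; [apply: (main x y)|apply: (main y x)] => //; rewrite addrC.
Qed.

End RealCone.
End Coordinates.

(** * Quasi-Frobenius elements and the bound on the type *)

Lemma mnm_vec_int_inj d : injective (@mnm_vec int d).
Proof.
move=> m m' /rowP E; apply/mnmP => i; have /eqP := E i.
by rewrite !mxE eqr_nat => /eqP.
Qed.

Lemma in_semigroupB d (S : {pred 'X_{1..d}}) a m :
  in_semigroup S (mnm_vec int a - mnm_vec int m) <->
  exists2 s, s \in S & a = (s + m)%MM.
Proof.
split=> [[s Ss E]|[s Ss ->]]; exists s => //; last by rewrite mnm_vecD addrK.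
by apply: mnm_vec_int_inj; rewrite mnm_vecD -E subrK.
Qed.

Lemma finite_le2 (T : choiceType) (P : T -> Prop) :
  (forall x y z, P x -> P y -> P z -> [\/ x = y, x = z | y = z]) ->
  exists2 Q : {fset T}, (forall x, x \in Q <-> P x) & (#|` Q| <= 2)%N.
Proof.
move=> h; have [[x Px]|/forallNP P0] := EM (exists x, P x); last first.
  by exists fset0; rewrite ?cardfs0 // => x; rewrite inE; split => // /P0.
have [[y [Py xy]]|/forallNP P1] := EM (exists y, P y /\ x != y); last first.
  exists [fset x]%fset; rewrite ?cardfs1 // => y; rewrite inE.
  split=> [/eqP -> //|Py]; apply: contrapT => /negP yx; apply: (P1 y).
  by rewrite eq_sym.
exists [fset x; y]%fset; last by rewrite cardfs2; case: eqP.
move=> z; rewrite !inE; split=> [/orP[] /eqP -> //|Pz].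
have [/eqP|->|->] := h x y z Px Py Pz; rewrite ?eqxx ?orbT //.
by rewrite (negbTE xy).
Qed.

Theorem theorem3p5 (R : realType) (d : nat) (d_gt0 : (0 < d)%N)
    (S : affine_semigroup d) (K : fieldType) :
  simplicial S ->
  embedding_dim S (d + 2)%N ->
  cohen_macaulay (semigroup_ring K S) ->
  exists2 n : nat, has_type R S n & (n <= 2)%N.
Proof.
move=> [A0 [[genA0 _] [b [bA0 b_free b_rad]]]] [A [genA _] cardA] CM.
have Sb i : b i \in S by exact: generates_sub genA0 (bA0 i).
have [e eP] := choice (smallest_on_ray b_free Sb b_rad).
have eS i : e i \in S by case: (eP i).
have e0 i : e i != 0%MM by case: (eP i).
have conn := cohen_macaulay_connected eS e0 (coordD b)
  (fun m i => @coord_ge0 d b b_free S b_rad m i) (coord_eq0 b_free)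
  (fun i j => let: And4 _ _ r _ := eP i in r j)
  (smallest_radical b_free Sb b_rad eP) CM.
(* The [e i] lie in every generating set, so [A] need not be compared with the set [A0] containing
   the [b i]. *)
have eA i : e i \in A := generates_smallest b_free b_rad eP i genA.
pose E := [fset e i | i in 'I_d]%fset.
have EP a : a \in E <-> exists i, a = e i.
  split=> [/imfsetP[i _ ->]|[i ->]]; first by exists i.
  by apply/imfsetP; exists i.
have EA : (E `<=` A)%fset by apply/fsubsetP => a /EP[i ->].
have cardE : #|` E| = d.
  by rewrite card_imfset /= ?size_enum_ord -?cardE ?card_ord //; exact: e_inj eP.
have : size (A `\` E)%fset = 2.
  by have := cardfsDS EA; rewrite cardA cardE addKn.
case def_bc : (enum_fset (A `\` E)%fset) => [|x [|y [|]]] // _.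
have AE : perm_eq [seq a <- A | a \notin E] [:: x; y].
  rewrite -def_bc; apply: uniq_perm => [||a].
  - by rewrite filter_uniq // fset_uniq.
  - exact: fset_uniq.
  - by rewrite mem_filter in_fsetD.
have Sxy a : a \in [:: x; y] -> a \in S.
  by rewrite -(perm_mem AE) mem_filter => /andP[_]; exact: generates_sub.
have Sx : x \in S by apply: Sxy; rewrite inE eqxx.
have Sy : y \in S by apply: Sxy; rewrite !inE eqxx orbT.
have apery_gen w : is_apery S e w -> exists l m, w = (x *+ l + y *+ m)%MM.
  move=> [Sw Aw]; have [c wE] := (genA w).1 Sw.
  (* An occurrence of [e i] could be split off from [w] inside [S], so only the two generators
     outside [E] remain. *)
  have cE i : c (e i) = 0%N.
    apply/eqP; rewrite -leqn0 leqNgt; apply/negP => ci.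
    apply: (Aw i (e i *+ (c (e i)).-1 + \sum_(a <- (A `\ e i)%fset) a *+ c a)%MM).
      apply: semigroupD; first exact: affine_semigroupMn.
      rewrite big_seq; elim/big_ind: _ => [|u v|a].
      + exact: semigroup0.
      + exact: semigroupD.
      + by rewrite !inE => /andP[_ /(generates_sub genA) Sa]; exact: affine_semigroupMn.
    by rewrite wE (big_fsetD1 (e i)) //= -{1}(prednK ci) mulmSr -!addmA [(e i + _)%MM]addmC.
  exists (c x), (c y); rewrite wE (bigID (mem E)) /= big1_seq ?add0m; last first.
    by move=> a /andP[/EP[i ->] _]; rewrite cE mulm0n.
  by rewrite -big_filter (perm_big _ AE) /= big_cons big_seq1.
have aperyP w : apery S E w <-> is_apery S e w.
  split=> -[Sw Aw]; split=> //.
    move=> i m Sm wE; apply: (Aw (e i)); first by apply/EP; exists i.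
    by apply/in_semigroupB; exists m.
  by move=> _ /EP[i ->] /in_semigroupB[m Sm]; exact: Aw.
have maxP w : max_apery S E w -> is_max S e w.
  move=> [/aperyP Aw mw]; split=> // s Ss /aperyP As; apply: mw => //.
  by apply/in_semigroupB; exists s => //; rewrite addmC.
have [] := @finite_le2 _ (quasi_frobenius S E).
  move=> _ _ _ [w1 /maxP m1 ->] [w2 /maxP m2 ->] [w3 /maxP m3 ->].
  have [->|->|->] := max_le2 e0 conn eS Sx Sy apery_gen m1 m2 m3.
  - by constructor 1.
  - by constructor 2.
  - by constructor 3.
move=> Q QP cardQ; exists #|` Q|%fset => //; exists E; last by exists Q.
move=> a; apply: (iff_trans (EP a)); apply: iff_sym.
exact: (extremal_rayP b_free Sb b_rad eP).
Qed.
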